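(* Let $L>0$, $\mu\ge0$, and let $f:\mathbb{R}^n\to\mathbb{R}$ be $L$-smooth and $\mu$-strongly convex with a minimizer $x_*$. Let $\beta\in[0,1)$ and $$\alpha=\min\left\{\frac{1-\beta}{4L},\ \frac{(1-\beta)^2}{4L\sqrt{3\beta}}\right\},$$ where for $\beta=0$ the second term in the minimum is read as $+\infty$. Let $x_0\in\mathbb{R}^n$, $R_0>0$ with $R_0\ge\|x_0-x_*\|_2$, and let $\overline{x}_K$ be the output after $K$ iterations of the Weighted Averaged Heavy-Ball method with stepsize $\alpha$, momentum parameter $\beta$, starting points $x_0$ and $x_1=x_0-\alpha\nabla f(x_0)$, and weights $w_k=\left(1-\frac{\alpha\mu}{2(1-\beta)}\right)^{-(k+1)}$. Then, to achieve $f(\overline{x}_K)-f(x_* )\le\varepsilon$ for $\varepsilon>0$, the method requires $$\mathcal{O}\left(\left(\frac L\mu+\frac{L\sqrt\beta}{\mu(1-\beta)}\right)\log\frac{LR_0^2\left(1+\frac{\sqrt\beta}{1-\beta}\right)}{\varepsilon}\right)$$ iterations when $\mu>0$, and $$\mathcal{O}\left(\frac{LR_0^2}{\varepsilon}+\frac{LR_0^2\sqrt\beta}{(1-\beta)\varepsilon}\right)$$ iterations when $\mu=0$. Precisely, there is an absolute constant $C>0$ (independent of $f,n,L,\mu,\beta,x_0,R_0,\varepsilon$) such that $f(\overline{x}_K)-f(x_* )\le\varepsilon$ holds for every integer $K\ge0$ with $K\ge C\left(\frac L\mu+\frac{L\sqrt\beta}{\mu(1-\beta)}\right)\max\left\{1,\log\frac{LR_0^2\left(1+\frac{\sqrt\beta}{1-\beta}\right)}{\varepsilon}\right\}$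 if $\mu>0$, and for every integer $K\ge0$ with $K\ge C\left(\frac{LR_0^2}{\varepsilon}+\frac{LR_0^2\sqrt\beta}{(1-\beta)\varepsilon}\right)$ if $\mu=0$.
   Context: A differentiable $f:\mathbb{R}^n\to\mathbb{R}$ is $L$-smooth if $\|\nabla f(x)-\nabla f(y)\|_2\le L\|x-y\|_2$ for all $x,y$. It is $\mu$-strongly convex ($\mu\ge0$; $\mu=0$ means convex) if $f(y)\ge f(x)+\langle\nabla f(x),y-x\rangle+\frac\mu2\|y-x\|_2^2$ for all $x,y$. Weighted Averaged Heavy-Ball method (WAHB) with stepsize $\alpha>0$, momentum parameter $\beta$, starting points $x_0,x_1$ and positive weights $w_0,w_1,\dots$: for $k\ge1$, $x_{k+1}=x_k-\alpha\nabla f(x_k)+\beta(x_k-x_{k-1})$; and for every $K\ge0$, $\overline{x}_K=\frac1{W_K}\sum_{i=0}^Kw_ix_i$ with $W_K=\sum_{i=0}^Kw_i$. *)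

(* Defs.v *)
From HB Require Import structures.
From mathcomp Require Import all_boot all_order all_algebra.
From mathcomp Require Import all_classical all_reals all_analysis.

Set Implicit Arguments.
Unset Strict Implicit.
Unset Printing Implicit Defensive.
Import Order.TTheory GRing.Theory Num.Theory.
Import numFieldNormedType.Exports.
Local Open Scope ring_scope.

(* R^n is 'rV[R]_n. The library norm `|x| on row vectors is the sup norm, so
   the Euclidean structure is introduced separately. Differentiability does not
   depend on the choice between the two (equivalent) norms. *)

Definition dotv (R : realType) (n : nat) (u v : 'rV[R]_n) : R :=
  \sum_(i < n) u 0 i * v 0 i.

Definition norm2 (R : realType) (n : nat) (u : 'rV[R]_n) : R :=
  Num.sqrt (dotv u u).

(* Meaningful only where f is differentiable; L_smooth includes
   differentiability everywhere. *)
Definition grad (R : realType) (n : nat) (f : 'rV[R]_n -> R) (x : 'rV[R]_n) :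
    'rV[R]_n :=
  \row_(i < n) 'D_(delta_mx 0 i) f x.

Definition L_smooth (R : realType) (n : nat) (L : R) (f : 'rV[R]_n -> R) : Prop :=
  (forall x, differentiable f x) /\
  (forall x y, norm2 (grad f x - grad f y) <= L * norm2 (x - y)).

Definition strongly_convex (R : realType) (n : nat) (mu : R)
    (f : 'rV[R]_n -> R) : Prop :=
  forall x y,
    f x + dotv (grad f x) (y - x) + mu / 2 * norm2 (y - x) ^+ 2 <= f y.

Definition minimizer (R : realType) (n : nat) (f : 'rV[R]_n -> R)
    (xs : 'rV[R]_n) : Prop :=
  forall y, f xs <= f y.

Definition heavy_ball (R : realType) (n : nat) (f : 'rV[R]_n -> R)
    (alpha beta : R) (x : nat -> 'rV[R]_n) : Prop :=
  forall k, (1 <= k)%N ->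
    x k.+1 = x k - alpha *: grad f (x k) + beta *: (x k - x k.-1).

Definition weighted_avg (R : realType) (n : nat) (w : nat -> R)
    (x : nat -> 'rV[R]_n) (K : nat) : 'rV[R]_n :=
  (\sum_(0 <= i < K.+1) w i)^-1 *: \sum_(0 <= i < K.+1) w i *: x i.

(* The case split reads the second term as +oo when beta = 0 (here a / 0 = 0). *)
Definition wahb_stepsize (R : realType) (L beta : R) : R :=
  if beta == 0 then (1 - beta) / (4 * L)
  else Num.min ((1 - beta) / (4 * L))
               ((1 - beta) ^+ 2 / (4 * L * Num.sqrt (3 * beta))).

Definition wahb_weight (R : realType) (alpha beta mu : R) (k : nat) : R :=
  (1 - alpha * mu / (2 * (1 - beta))) ^- k.+1.

(* Main.v *)
Require Import Defs.
From HB Require Import structures.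
From mathcomp Require Import all_boot all_order all_algebra.
From mathcomp Require Import all_classical all_reals all_analysis.
From mathcomp Require Import ring lra.

Set Implicit Arguments.
Unset Strict Implicit.
Unset Printing Implicit Defensive.
Import Order.TTheory GRing.Theory Num.Theory.
Import numFieldNormedType.Exports.
Local Open Scope ring_scope.

(** Write [D k = f (x k) - f xs], [h = alpha / (1 - beta)], [q = 1 - h mu / 2]
and [B = beta / (1 - beta)]. The momentum is removed by passing to the virtual
iterates [y k = x k + B (x k - x (k-1))], with [x (-1) = x 0]. Since
[1 + B = 1 / (1 - beta)], they perform plain gradient steps of length [h], but
with gradients taken at [x k]: [y (k+1) = y k - h grad f (x k)]. Here the choice
[x 1 = x 0 - alpha grad f (x 0)] makes the recursion hold from [k = 0] on.

The usual analysis of gradient descent then contracts the squared distance from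
[y k] to [xs] by [q] and gains a multiple of [h D k], up to an error
[5 h L B^2 |x k - x (k-1)|^2] caused by evaluating the gradient at [x k] instead
of [y k]. The displacement itself shrinks by [beta] at each step and is fed by
[|grad f (x k)|^2 <= 2 L D k]. Adding [c |x k - x (k-1)|^2] to the squared
distance therefore gives a Lyapunov function [V] with
[V (k+1) + h/2 D k <= q V k] (lemma [lyapunov_step]), provided that
- [q - beta] is at least a fixed multiple of [1 - beta], so that the extra term
  can absorb the error while contracting by [q] (lemma [contraction_gap]);
- the gain [2 c L alpha^2 / (1 - beta)] of the extra term is a fraction of [h].
Both follow from the two terms of the minimum defining the stepsize: the first
is [4 L h <= 1], the second [48 L^2 beta h^2 <= (1 - beta)^2].

Multiplying by [w k = q^-(k+1)] makes the inequalities telescope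
([weighted_telescope]), and Jensen's inequality gives
[W_K (f (xbar K) - f xs) <= 2 R0^2 / h <= 16 A] with
[A = L R0^2 (1 + sqrt beta / (1 - beta))] ([weighted_suboptimality]). It remains
to bound [W_K] below: by [K + 1] when [mu = 0], and by
[w K >= exp (h mu K / 2)] when [mu > 0]. The constant [C = 80] serves in both
cases. *)

(** * Euclidean structure of row vectors *)

Lemma dotvC (R : realType) (n : nat) (u v : 'rV[R]_n) : dotv u v = dotv v u.
Proof. by apply: eq_bigr => i _; rewrite mulrC. Qed.

Lemma dotvDl (R : realType) (n : nat) (u v w : 'rV[R]_n) :
  dotv (u + v) w = dotv u w + dotv v w.
Proof.
by rewrite /dotv -big_split; apply: eq_bigr => i _; rewrite mxE mulrDl.
Qed.

Lemma dotvZl (R : realType) (n : nat) (a : R) (u v : 'rV[R]_n) :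
  dotv (a *: u) v = a * dotv u v.
Proof.
by rewrite /dotv mulr_sumr; apply: eq_bigr => i _; rewrite mxE mulrA.
Qed.

Lemma dotvDr (R : realType) (n : nat) (u v w : 'rV[R]_n) :
  dotv w (u + v) = dotv w u + dotv w v.
Proof. by rewrite dotvC dotvDl !(dotvC w). Qed.

Lemma dotvZr (R : realType) (n : nat) (a : R) (u v : 'rV[R]_n) :
  dotv v (a *: u) = a * dotv v u.
Proof. by rewrite dotvC dotvZl dotvC. Qed.

Lemma dotvNl (R : realType) (n : nat) (u v : 'rV[R]_n) :
  dotv (- u) v = - dotv u v.
Proof. by rewrite -scaleN1r dotvZl mulN1r. Qed.

Lemma dotvNr (R : realType) (n : nat) (u v : 'rV[R]_n) :
  dotv v (- u) = - dotv v u.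
Proof. by rewrite dotvC dotvNl dotvC. Qed.

Lemma dotv0l (R : realType) (n : nat) (v : 'rV[R]_n) : dotv 0 v = 0.
Proof. by rewrite -(scale0r v) dotvZl mul0r. Qed.

Lemma dotv0r (R : realType) (n : nat) (v : 'rV[R]_n) : dotv v 0 = 0.
Proof. by rewrite dotvC dotv0l. Qed.

Lemma dotv_sumr (R : realType) (n : nat) (I : Type) (r : seq I)
    (F : I -> 'rV[R]_n) (v : 'rV[R]_n) :
  dotv v (\sum_(i <- r) F i) = \sum_(i <- r) dotv v (F i).
Proof.
elim/big_ind2: _ => [|a b c d <- <-|//]; first by rewrite dotv0r.
by rewrite dotvDr.
Qed.

Definition dotvE := (dotvDl, dotvDr, dotvZl, dotvZr, dotvNl, dotvNr).

Lemma dotvv_ge0 (R : realType) (n : nat) (u : 'rV[R]_n) : 0 <= dotv u u.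
Proof. by apply: sumr_ge0 => i _; rewrite -expr2 sqr_ge0. Qed.

Lemma dotvv_eq0 (R : realType) (n : nat) (u : 'rV[R]_n) :
  (dotv u u == 0) = (u == 0).
Proof.
apply/idP/eqP => [|->]; last by rewrite dotv0l.
rewrite psumr_eq0 => [/allP u0|i _]; last by rewrite -expr2 sqr_ge0.
apply/rowP => i; rewrite mxE; apply/eqP.
by have := u0 i (mem_index_enum i); rewrite /= mulf_eq0 orbb.
Qed.

Lemma norm2_ge0 (R : realType) (n : nat) (u : 'rV[R]_n) : 0 <= norm2 u.
Proof. exact: sqrtr_ge0. Qed.

Lemma norm2_sqr (R : realType) (n : nat) (u : 'rV[R]_n) :
  norm2 u ^+ 2 = dotv u u.
Proof. by rewrite sqr_sqrtr // dotvv_ge0. Qed.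

(** Cauchy-Schwarz, from the nonnegativity of the squared length of
[|v|^2 u - <u, v> v], which equals [|v|^2 (|u|^2 |v|^2 - <u, v>^2)]. *)
Lemma dotv_norm2_le (R : realType) (n : nat) (u v : 'rV[R]_n) :
  dotv u v <= norm2 u * norm2 v.
Proof.
have [->|v0] := eqVneq v 0.
  by rewrite dotv0r mulr_ge0 // norm2_ge0.
have vv : 0 < dotv v v by rewrite lt0r dotvv_eq0 v0 dotvv_ge0.
rewrite (le_trans (ler_norm _)) // -sqrtrM ?dotvv_ge0 // -sqrtr_sqr.
rewrite ler_sqrt ?mulr_ge0 ?dotvv_ge0 // -(ler_pM2l vv) -subr_ge0.
have := dotvv_ge0 (dotv v v *: u - dotv u v *: v).
rewrite !dotvE (dotvC v u); congr (0 <= _); ring.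
Qed.

(** * Smooth and strongly convex functions *)

(** The gradient is built from partial derivatives only; differentiability is
what turns it into the representative of all directional derivatives. *)
Lemma derive_grad (R : realType) (n : nat) (f : 'rV[R]_n -> R)
    (x d : 'rV[R]_n) :
  differentiable f x -> 'D_d f x = dotv (grad f x) d.
Proof.
move=> fx; rewrite deriveE // [in LHS](row_sum_delta d) linear_sum.
apply: eq_bigr => i _; rewrite linearZ /= mxE deriveE //.
by rewrite mulrC.
Qed.

Lemma is_derive_line (R : realType) (n : nat) (f : 'rV[R]_n -> R)
    (x d : 'rV[R]_n) (t : R) :
  differentiable f (x + t *: d) ->
  is_derive t (1 : R) (fun s => f (x + s *: d)) (dotv (grad f (x + t *: d)) d).
Proof.
move=> ft.
have E : (fun h : R => h^-1 *: (((fun s => f (x + s *: d)) \o shift t) (h *: (1 : R))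
    - f (x + t *: d))) =
  (fun h : R => h^-1 *: ((f \o shift (x + t *: d)) (h *: d) - f (x + t *: d))).
  apply/funext => h /=; congr (_ *: (f _ - _)).
  by rewrite (mulr1 h : h *: (1 : R) = h) scalerDl addrCA.
apply: DeriveDef; first by rewrite /derivable E; exact: diff_derivable.
by rewrite -derive_grad // /derive E.
Qed.

(** Along the segment from [x] to [y = x + d], the difference [phi] between [f]
and its quadratic upper model has derivative
[<grad f (x + t d) - grad f x, d> - L t |d|^2], which is nonpositive by
Cauchy-Schwarz and the Lipschitz bound. The mean value theorem replaces the
integral of the textbook proof. *)
Lemma descent_lemma (R : realType) (n : nat) (L : R) (f : 'rV[R]_n -> R)
    (x y : 'rV[R]_n) :
  L_smooth L f ->
  f y <= f x + dotv (grad f x) (y - x) + L / 2 * dotv (y - x) (y - x).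
Proof.
move=> [fd fL]; set d := y - x.
pose line := fun t : R => f (x + t *: d).
pose para : R -> R := (dotv (grad f x) d) *: id + (L / 2 * dotv d d) *: (id ^+ 2).
pose phi := line - para.
pose dphi t := dotv (grad f (x + t *: d)) d -
  (dotv (grad f x) d + L * t * dotv d d).
have phid (t : R) : is_derive t (1 : R) phi (dphi t).
  have lined : is_derive t (1 : R) line (dotv (grad f (x + t *: d)) d).
    exact: is_derive_line.
  have parad : is_derive t (1 : R) para (dotv (grad f x) d + L * t * dotv d d).
    have idd : is_derive t (1 : R) (id : R -> R) (1 : R) by exact: is_derive_id.
    have sqd : is_derive t (1 : R) (id ^+ 2 : R -> R) ((2%:R * t) *: (1 : R)).
      exact: (is_deriveX 2 idd).
    have sumd := is_deriveD (is_deriveZ (dotv (grad f x) d) idd)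
                            (is_deriveZ (L / 2 * dotv d d) sqd).
    by apply: (is_derive_eq sumd); rewrite /GRing.scale /= !mulr1; field.
  exact: is_deriveB.
have cphi : {within `[0, 1], continuous phi}%classic.
  by apply: derivable_within_continuous => t _; exact: (@ex_derive _ _ _ _ _ _ _ (phid t)).
have [t t01] := MVT ltr01 (fun t _ => phid t) cphi.
have phi0 : phi 0 = f x.
  by rewrite /phi /line /para !fctE /= scale0r addr0 expr0n /= !scaler0 addr0 subr0.
have phi1 : phi 1 = f y - (dotv (grad f x) d + L / 2 * dotv d d).
  by rewrite /phi /line /para !fctE /= scale1r /d [x + _]addrC subrK expr1n /GRing.scale /= !mulr1.
rewrite phi0 phi1.
have tpos : 0 < t by move: t01; rewrite in_itv /= => /andP[].
suff : dphi t <= 0 by lra.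
have := dotv_norm2_le (grad f (x + t *: d) - grad f x) d.
have := fL (x + t *: d) x; rewrite [x + _]addrC addrK => Ht.
have -> : dphi t = dotv (grad f (t *: d + x) - grad f x) d - t * L * dotv d d.
  by rewrite /dphi dotvDl dotvNl (addrC x); ring.
have nt : norm2 (t *: d) = t * norm2 d.
  by rewrite /norm2 dotvZl dotvZr mulrA -expr2 sqrtrM ?sqr_ge0 // sqrtr_sqr gtr0_norm //.
rewrite nt in Ht => CS.
have : norm2 (grad f (t *: d + x) - grad f x) * norm2 d <= t * L * dotv d d.
  rewrite -norm2_sqr; apply: le_trans (ler_wpM2r (norm2_ge0 d) Ht) _.
  by rewrite le_eqVlt; apply/orP; left; apply/eqP; ring.
by move=> H; lra.
Qed.

(** The gradient step [x - grad f x / L] decreases [f] by at least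
[|grad f x|^2 / (2 L)], and [f] cannot go below its minimum. *)
Lemma grad_sqr_le (R : realType) (n : nat) (L : R) (f : 'rV[R]_n -> R)
    (x xs : 'rV[R]_n) :
  0 < L -> L_smooth L f -> minimizer f xs ->
  dotv (grad f x) (grad f x) <= 2 * L * (f x - f xs).
Proof.
move=> L0 fL fmin.
have := le_trans (fmin _) (descent_lemma x (x - L^-1 *: grad f x) fL).
rewrite [x - _]addrC addrK !dotvE; set G := dotv _ _ => H.
have -> : G = 2 * L * (G / (2 * L)) by field; rewrite gt_eqF.
rewrite ler_pM2l ?mulr_gt0 //.
have <- : L^-1 * G - L / 2 * - (L^-1 * - (L^-1 * G)) = G / (2 * L).
  by field; rewrite gt_eqF.
lra.
Qed.

(** The quadratic lower and upper bounds of [f] at 0 are compared at a nonzero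
vector; this is why the dimension has to be positive. *)
Lemma strong_convexity_le_smoothness (R : realType) (n : nat) (L mu : R)
    (f : 'rV[R]_n.+1 -> R) :
  L_smooth L f -> strongly_convex mu f -> mu <= L.
Proof.
move=> fL fmu; pose e : 'rV[R]_n.+1 := delta_mx 0 0.
have ee : 0 < dotv e e.
  rewrite lt0r dotvv_ge0 dotvv_eq0 andbT; apply/eqP => /rowP/(_ 0).
  by rewrite !mxE !eqxx => /eqP; rewrite oner_eq0.
have := le_trans (fmu 0 e) (descent_lemma 0 e fL).
rewrite norm2_sqr subr0 lerD2l => H.
have : mu / 2 <= L / 2 by rewrite -(ler_pM2r ee).
by move=> ?; lra.
Qed.

(** The tangent hyperplane at the average [z] lies below [f]; averaged over the
points [x i], its linear part vanishes because [z] is their barycentre. *)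
Lemma jensen_weighted_avg (R : realType) (n : nat) (mu : R)
    (f : 'rV[R]_n -> R) (w : nat -> R) (x : nat -> 'rV[R]_n) (K : nat) :
  0 <= mu -> strongly_convex mu f -> (forall i, 0 < w i) ->
  (\sum_(0 <= i < K.+1) w i) * f (weighted_avg w x K) <=
  \sum_(0 <= i < K.+1) w i * f (x i).
Proof.
move=> mu0 fmu w0; set W := \sum_(0 <= i < K.+1) w i; set z := weighted_avg _ _ _.
have W0 : 0 < W.
  by rewrite /W big_nat_recr //= ltr_wpDl // sumr_ge0 // => i _; exact: ltW.
have bary : \sum_(0 <= i < K.+1) w i *: (x i - z) = 0.
  under eq_bigr do rewrite scalerBr.
  by rewrite sumrB -scaler_suml /z /weighted_avg scalerA divff ?gt_eqF // scale1r subrr.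
have -> : W * f z = \sum_(0 <= i < K.+1) w i * (f z + dotv (grad f z) (x i - z)).
  under eq_bigr do rewrite mulrDr -dotvZr.
  by rewrite big_split /= -dotv_sumr bary -mulr_suml dotv0r addr0.
apply: ler_sum => i _; rewrite ler_pM2l //.
apply: le_trans (fmu z (x i)).
by rewrite lerDl mulr_ge0 ?sqr_ge0 // divr_ge0.
Qed.

(** * Stepsize *)

(** All that the analysis uses of the stepsize. The first two inequalities say
that it is below each term of the minimum, cleared of the square root; the last
one says that it is not much smaller, which is where the factor
[1 + sqrt beta / (1 - beta)] of the rates comes from. *)
Lemma wahb_stepsizeP (R : realType) (L beta : R) :
  0 < L -> 0 <= beta -> beta < 1 ->
  let alpha := wahb_stepsize L beta in
  [/\ 0 < alpha, 4 * L * alpha <= 1 - beta,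
      48 * L ^+ 2 * beta * alpha ^+ 2 <= (1 - beta) ^+ 4 &
      1 - beta <= 8 * L * alpha * (1 + Num.sqrt beta / (1 - beta))].
Proof.
move=> L0 b0 b1; have t0 : 0 < 1 - beta by rewrite subr_gt0.
have L4 : 0 < 4 * L by lra.
have a1 : 4 * L * ((1 - beta) / (4 * L)) = 1 - beta by field; rewrite gt_eqF.
rewrite /wahb_stepsize; have [bz|bn0] := eqVneq beta 0.
  rewrite bz subr0 in a1 *; split.
  - by rewrite divr_gt0.
  - by rewrite a1.
  - by rewrite mulr0 mul0r expr1n.
  - by rewrite sqrtr0 mul0r addr0 mulr1; lra.
have bp : 0 < beta by rewrite lt0r bn0.
set s := Num.sqrt beta; set s3 := Num.sqrt (3 * beta).
have sp : 0 < s by rewrite sqrtr_gt0.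
have s3p : 0 < s3 by rewrite sqrtr_gt0 mulr_gt0.
have s3E : s3 ^+ 2 = 3 * beta by rewrite sqr_sqrtr // mulr_ge0.
have sE : s ^+ 2 = beta by rewrite sqr_sqrtr.
have s32 : s3 <= 2 * s.
  (* sqrt 3 <= 2 *)
  rewrite -(@ler_pXn2r _ 2) ?nnegrE ?mulr_ge0 // ?ltW //.
  by rewrite s3E exprMn sE; lra.
set A := (1 - beta) / (4 * L) in a1 *.
set B := (1 - beta) ^+ 2 / (4 * L * s3).
have a2 : 4 * L * s3 * B = (1 - beta) ^+ 2.
  by rewrite /B; field; rewrite !gt_eqF.
have A0 : 0 < A by rewrite divr_gt0.
have B0 : 0 < B by rewrite divr_gt0 ?exprn_gt0 ?mulr_gt0.
set al := Num.min A B.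
have al0 : 0 < al by rewrite lt_min A0.
have alA : al <= A by rewrite ge_min lexx.
have alB : al <= B by rewrite ge_min lexx orbT.
have alE : al = A \/ al = B by rewrite /al minEle; case: ifP; [left|right].
clearbody al A B; split=> //.
- by rewrite -a1 ler_pM2l.
- have -> : 48 * L ^+ 2 * beta * al ^+ 2 = (4 * L * s3 * al) ^+ 2.
    by rewrite !exprMn s3E; ring.
  rewrite (exprM _ 2 2) -a2 lerXn2r ?nnegrE //.
  + by rewrite ltW // !mulr_gt0.
  + by rewrite ltW // !mulr_gt0.
  + by rewrite ler_pM2l // !mulr_gt0.
have sq : 0 < s / (1 - beta) by rewrite divr_gt0.
case: alE => ->.
  have := mulr_gt0 (mulr_gt0 L0 A0) sq.
  by move=> ?; lra.
have -> : 8 * L * B * (1 + s / (1 - beta)) =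
   8 * L * B + (4 * L * (2 * s) * B) / (1 - beta) by field; rewrite gt_eqF.
have : (1 - beta) ^+ 2 / (1 - beta) <= (4 * L * (2 * s) * B) / (1 - beta).
  rewrite ler_pM2r ?invr_gt0 // -a2 ler_pM2r // ler_pM2l //.
rewrite expr2 mulfK ?gt_eqF //.
have : 0 <= L * B by rewrite mulr_ge0 // ltW.
by move=> *; lra.
Qed.

(** What is needed is [h L <= 3/8 (1 - beta)]. For [beta <= 1/3] the bound
[h L <= 1/4] is enough; for larger [beta] the second constraint, in which
[beta] can be replaced by [1/3], gives [h L <= (1 - beta) / 4]. *)
Lemma contraction_gap (R : realType) (h L mu beta : R) :
  0 <= beta -> beta < 1 -> 0 < h -> 0 < L -> mu <= L ->
  4 * L * h <= 1 -> 48 * L ^+ 2 * beta * h ^+ 2 <= (1 - beta) ^+ 2 ->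
  13 / 16 * (1 - beta) <= 1 - h * mu / 2 - beta.
Proof.
move=> b0 b1 h0 L0 muL hL1 hL2.
have hmu : h * mu <= h * L by rewrite ler_pM2l.
suff : h * L <= 3 / 8 * (1 - beta) by move=> ?; lra.
have [bs|bl] := lerP beta (1 / 3); first by lra.
suff : 4 * (h * L) <= 1 - beta by move=> ?; lra.
have hL0 : 0 < h * L by rewrite mulr_gt0.
have hL40 : 0 <= 4 * (h * L) by lra.
have t0 : 0 <= 1 - beta by lra.
rewrite -(@ler_pXn2r _ 2) ?nnegrE //; apply: le_trans hL2.
have -> : 48 * L ^+ 2 * beta * h ^+ 2 = 48 * beta * (h * L) ^+ 2 by ring.
by rewrite exprMn ler_pM2r ?exprn_gt0 //; lra.
Qed.

(** * One step of the method *)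

(** One iteration in terms of [u = x k - xs], the displacement
[s = x k - x (k-1)] and the gradient [g] at [x k]; then [u + B s] is the offset
of the virtual iterate and [s'] the next displacement. The weight [c] is the
solution of [5 h L B^2 = 13/16 (1 - beta) c], the least one for which the
contraction gap absorbs the error term. *)
Lemma lyapunov_step (R : realType) (n : nat) (L mu beta h D : R)
    (u s g : 'rV[R]_n) :
  0 < L -> 0 <= mu -> mu <= L -> 0 <= beta -> beta < 1 -> 0 < h ->
  4 * L * h <= 1 -> 48 * L ^+ 2 * beta * h ^+ 2 <= (1 - beta) ^+ 2 ->
  dotv g g <= 2 * L * D -> D + mu / 2 * dotv u u <= dotv g u ->
  let B := beta / (1 - beta) in
  let c := 80 / 13 * h * L * B ^+ 2 / (1 - beta) in
  let s' := beta *: s - (h * (1 - beta)) *: g in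
  dotv (u + B *: s - h *: g) (u + B *: s - h *: g) + c * dotv s' s'
    + h / 2 * D <=
  (1 - h * mu / 2) * (dotv (u + B *: s) (u + B *: s) + c * dotv s s).
Proof.
move=> L0 mu0 muL b0 b1 h0 hL1 hL2 gD cvx; cbv zeta.
set B := beta / (1 - beta); set c := 80 / 13 * h * L * B ^+ 2 / (1 - beta).
set s' := beta *: s - _.
have t0 : 0 < 1 - beta by rewrite subr_gt0.
have tn0 : 1 - beta != 0 by rewrite gt_eqF.
have gap := contraction_gap b0 b1 h0 L0 muL hL1 hL2.
have B0 : 0 <= B by rewrite divr_ge0 // ltW.
have c0 : 0 <= c by rewrite !mulr_ge0 ?sqr_ge0 ?invr_ge0 // ltW.
have D0 : 0 <= D.
  by have := le_trans (dotvv_ge0 g) gD; rewrite pmulr_rge0 // mulr_gt0.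
have ss0 := dotvv_ge0 s.
(* Convexity of the square, for s' = beta s + (1 - beta) (- h g). *)
have E1 : dotv s' s' <= beta * dotv s s + h ^+ 2 * (1 - beta) * dotv g g.
  have : 0 <= beta * (1 - beta) * dotv (s + h *: g) (s + h *: g).
    by rewrite !mulr_ge0 ?dotvv_ge0 // ltW.
  rewrite -[dotv s' s' <= _]subr_ge0; congr (0 <= _).
  by rewrite /s' !dotvE (dotvC g s); ring.
(* The gradient is evaluated at a point that differs by B s from the virtual
   iterate: Young's inequality with the weight that spends D / 2 on g. *)
have E2 : - (2 * B * dotv g s) <= dotv g g / (4 * L) + 4 * L * B ^+ 2 * dotv s s.
  have : 0 <= dotv (g + (4 * L * B) *: s) (g + (4 * L * B) *: s) / (4 * L).
    by rewrite divr_ge0 ?dotvv_ge0 // mulr_ge0 // ltW.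
  rewrite -[- _ <= _]subr_ge0; congr (0 <= _).
  by rewrite !dotvE (dotvC s g); field; rewrite gt_eqF.
(* Strong convexity controls u, whereas the contraction is wanted for u + B s. *)
have E3 : dotv (u + B *: s) (u + B *: s) <=
    2 * dotv u u + 2 * B ^+ 2 * dotv s s.
  have := dotvv_ge0 (u - B *: s).
  rewrite -[dotv (u + _) _ <= _]subr_ge0; congr (0 <= _).
  by rewrite !dotvE (dotvC s u); ring.
have -> : dotv (u + B *: s - h *: g) (u + B *: s - h *: g) =
    dotv (u + B *: s) (u + B *: s) - 2 * h * dotv g u
    - h * (2 * B * dotv g s) + h ^+ 2 * dotv g g.
  by rewrite !dotvE (dotvC s u) (dotvC u g) (dotvC s g); ring.
set P := dotv (u + _) _ in E3 *.
have F0 : h * (D + mu / 2 * dotv u u) <= h * dotv g u by rewrite ler_pM2l.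
have F1 := ler_wpM2l c0 E1.
have F2 : h * - (2 * B * dotv g s) <=
    h * (dotv g g / (4 * L) + 4 * L * B ^+ 2 * dotv s s) by rewrite ler_pM2l.
have F3 : h * mu / 2 * P <= h * mu / 2 * (2 * dotv u u + 2 * B ^+ 2 * dotv s s).
  by apply: ler_wpM2l => //; rewrite divr_ge0 // mulr_ge0 // ltW.
(* The budget in multiples of h D: the gain is 2, the claim and F4, F5 take 1/2
   each, and F6 takes 10/39. *)
have F4 : h * (dotv g g / (4 * L)) <= h * (D / 2).
  rewrite ler_pM2l // ler_pdivrMr ?mulr_gt0 //; lra.
have F5 : h ^+ 2 * dotv g g <= h / 2 * D.
  have := ler_wpM2l (sqr_ge0 h) gD.
  have : (h * D) * (4 * L * h) <= (h * D) * 1.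
    by apply: ler_wpM2l => //; rewrite mulr_ge0 // ltW.
  by rewrite !expr2 => *; lra.
have F6 : c * (h ^+ 2 * (1 - beta) * dotv g g) <= h * (10 / 39 * D).
  have k0 : 0 <= h * L * B ^+ 2 * h ^+ 2 by rewrite !mulr_ge0 ?sqr_ge0 ?invr_ge0 // ltW.
  have -> : c * (h ^+ 2 * (1 - beta) * dotv g g) =
    80 / 13 * (h * L * B ^+ 2 * h ^+ 2 * dotv g g).
    by rewrite /c; field; rewrite tn0.
  have : h * L * B ^+ 2 * h ^+ 2 * dotv g g <= h * L * B ^+ 2 * h ^+ 2 * (2 * L * D).
    exact: ler_wpM2l.
  have : 48 * (L ^+ 2 * B ^+ 2 * h ^+ 2) <= 1.
    have -> : 48 * (L ^+ 2 * B ^+ 2 * h ^+ 2) =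
       (48 * L ^+ 2 * beta * h ^+ 2) * beta / (1 - beta) ^+ 2.
      by rewrite /B; field.
    rewrite ler_pdivrMr ?exprn_gt0 // mul1r.
    apply: le_trans (ler_wpM2r b0 hL2) _.
    by rewrite ler_piMr ?sqr_ge0 // ltW.
  move=> /(ler_wpM2l (mulr_ge0 (ltW h0) D0)) H1 H2.
  have -> : h * (10 / 39 * D) = 160 / (13 * 48) * (h * D) by field.
  by lra.
have F7 : 5 * h * L * B ^+ 2 <= c * (1 - h * mu / 2 - beta).
  apply: le_trans (ler_wpM2l c0 gap); rewrite le_eqVlt; apply/orP; left.
  by apply/eqP; rewrite /c; field; rewrite tn0.
have F8 := ler_wpM2r ss0 F7.
have F9 : h * mu * (B ^+ 2 * dotv s s) <= h * L * (B ^+ 2 * dotv s s).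
  by apply: ler_wpM2r; [rewrite mulr_ge0 // sqr_ge0|rewrite ler_pM2l].
have hD : 0 <= h * D by rewrite mulr_ge0 // ltW.
by lra.
Qed.

(** * Weighted average of the iterates *)

Lemma weighted_telescope (R : realType) (q : R) (V a : nat -> R) (K : nat) :
  0 < q -> (forall k, V k.+1 + a k <= q * V k) ->
  \sum_(0 <= i < K) q ^- i.+1 * a i + q ^- K * V K <= V 0%N.
Proof.
move=> q0 step; elim: K => [|K IH].
  by rewrite big_nil add0r expr0 invr1 mul1r.
apply: le_trans IH; rewrite big_nat_recr //= -addrA lerD2l -mulrDr addrC.
have -> : q ^- K * V K = q ^- K.+1 * (q * V K).
  by rewrite exprS invfM mulrCA !mulrA divff ?mul1r // gt_eqF.
by rewrite ler_pM2l // invr_gt0 exprn_gt0.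
Qed.

(** Reading [x (-1)] as [x 0], which is what truncated predecessor does, the
initial gradient step becomes an instance of the heavy-ball recursion. *)
Lemma heavy_ball_step (R : realType) (n : nat) (f : 'rV[R]_n -> R)
    (alpha beta : R) (x : nat -> 'rV[R]_n) (k : nat) :
  x 1%N = x 0%N - alpha *: grad f (x 0%N) -> heavy_ball f alpha beta x ->
  x k.+1 - x k = beta *: (x k - x k.-1) - alpha *: grad f (x k).
Proof.
move=> x1 hb; case: k => [|k] /=.
  by rewrite x1 subrr scaler0 add0r [x 0%N - _]addrC addrK.
by rewrite hb //=; apply/rowP => i; rewrite !mxE; ring.
Qed.

Lemma weighted_suboptimality (R : realType) (n : nat) (f : 'rV[R]_n -> R)
    (L mu beta : R) (xs : 'rV[R]_n) (x : nat -> 'rV[R]_n) (K : nat) :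
  0 < L -> 0 <= mu -> mu <= L -> L_smooth L f -> strongly_convex mu f ->
  minimizer f xs -> 0 <= beta -> beta < 1 ->
  let alpha := wahb_stepsize L beta in
  let w := wahb_weight alpha beta mu in
  x 1%N = x 0%N - alpha *: grad f (x 0%N) -> heavy_ball f alpha beta x ->
  (\sum_(0 <= i < K.+1) w i) * (f (weighted_avg w x K) - f xs) <=
  16 * (L * norm2 (x 0%N - xs) ^+ 2 * (1 + Num.sqrt beta / (1 - beta))).
Proof.
move=> L0 mu0 muL fL fmu fmin b0 b1 alpha w x1 hb.
have t0 : 0 < 1 - beta by rewrite subr_gt0.
have tn0 : 1 - beta != 0 by rewrite gt_eqF.
have [a0 aL1 aL2 aLb] := wahb_stepsizeP L0 b0 b1; rewrite -/alpha in a0 aL1 aL2 aLb.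
set S := 1 + Num.sqrt beta / _ in aLb *.
pose h := alpha / (1 - beta).
have ah : alpha = h * (1 - beta) by rewrite /h divfK.
have h0 : 0 < h by rewrite divr_gt0.
have hL1 : 4 * L * h <= 1.
  rewrite -(ler_pM2r t0) mul1r.
  by have -> : 4 * L * h * (1 - beta) = 4 * L * alpha by rewrite ah; ring.
have hL2 : 48 * L ^+ 2 * beta * h ^+ 2 <= (1 - beta) ^+ 2.
  rewrite -(ler_pM2r (exprn_gt0 2 t0)) -exprD.
  by have -> : 48 * L ^+ 2 * beta * h ^+ 2 * (1 - beta) ^+ 2 =
    48 * L ^+ 2 * beta * alpha ^+ 2 by rewrite ah; ring.
have hS : 1 <= 8 * L * h * S.
  rewrite -(ler_pM2r t0) mul1r.
  by have -> : 8 * L * h * S * (1 - beta) = 8 * L * alpha * S by rewrite ah; ring.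
pose q := 1 - h * mu / 2.
have q0 : 0 < q.
  have : h * mu <= h * L by rewrite ler_pM2l.
  by rewrite /q => ?; lra.
have wE i : w i = q ^- i.+1.
  by rewrite /w /wahb_weight /q /h; congr ((1 - _) ^- _); field; rewrite tn0.
have w0 i : 0 < w i by rewrite wE invr_gt0 exprn_gt0.
pose B := beta / (1 - beta).
pose c := 80 / 13 * h * L * B ^+ 2 / (1 - beta).
pose m k := x k - x k.-1.
pose y k := x k - xs + B *: m k.
pose V k := dotv (y k) (y k) + c * dotv (m k) (m k).
pose D k := f (x k) - f xs.
have Vstep k : V k.+1 + h / 2 * D k <= q * V k.
  have mE : m k.+1 = beta *: m k - (h * (1 - beta)) *: grad f (x k).
    by rewrite -ah; exact: heavy_ball_step.
  have yE : y k.+1 = y k - h *: grad f (x k).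
    have -> : y k.+1 = x k - xs + (1 + B) *: m k.+1.
      by rewrite /y /m /=; apply/rowP => i; rewrite !mxE; ring.
    rewrite mE /y; apply/rowP => i; rewrite !mxE /B; field; exact: tn0.
  rewrite /V yE mE.
  apply: lyapunov_step => //; first exact: grad_sqr_le.
  have := fmu (x k) xs; rewrite norm2_sqr -(opprB (x k)) !dotvE opprK.
  by rewrite /D => ?; lra.
have c0 : 0 <= c by rewrite !mulr_ge0 ?sqr_ge0 ?invr_ge0 // ltW.
have tele := weighted_telescope K.+1 q0 Vstep.
have V0 : V 0%N = norm2 (x 0%N - xs) ^+ 2.
  by rewrite norm2_sqr /V /y /m /= subrr scaler0 addr0 dotv0l mulr0 addr0.
have VK : 0 <= q ^- K.+1 * V K.+1.
  apply: mulr_ge0; first by rewrite -wE ltW.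
  by apply: addr_ge0; [|apply: mulr_ge0 => //]; exact: dotvv_ge0.
set W := \sum_(_ <= _ < _) _.
have W0 : 0 <= W by apply: sumr_ge0 => i _; exact: ltW.
have avg : W * (f (weighted_avg w x K) - f xs) <= \sum_(0 <= i < K.+1) w i * D i.
  rewrite mulrBr; under [leRHS]eq_bigr do rewrite mulrBr.
  by rewrite sumrB -mulr_suml lerB // (jensen_weighted_avg _ _ mu0 fmu).
have sumE : \sum_(0 <= i < K.+1) q ^- i.+1 * (h / 2 * D i) =
    h / 2 * \sum_(0 <= i < K.+1) w i * D i.
  by rewrite mulr_sumr; apply: eq_bigr => i _; rewrite wE mulrCA.
have gap : 0 <= W * (f (weighted_avg w x K) - f xs).
  by rewrite mulr_ge0 // subr_ge0.
set G := W * _ in avg gap *.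
have GV : h / 2 * G <= V 0%N.
  apply: le_trans (tele); rewrite sumE; apply: ler_wpDr => //.
  by rewrite ler_pM2l // divr_gt0.
have S0 : 0 <= 16 * L * S.
  by rewrite !mulr_ge0 ?addr_ge0 ?divr_ge0 ?sqrtr_ge0 // ltW.
have := ler_wpM2l S0 GV; have := ler_wpM2r gap hS.
by rewrite V0 => *; lra.
Qed.

(** * Convergence rates *)

(** In dimension 0 strong convexity holds for every [mu], so that [mu <= L] may
fail and the weights may be negative; there all points coincide. *)
Lemma scalar_fun_dim0 (R : realType) (f : 'rV[R]_0 -> R) (u v : 'rV[R]_0) :
  f u = f v.
Proof. by rewrite [u]thinmx0 [v]thinmx0. Qed.

Lemma ge_expR_geometric (R : realType) (q a : R) (k : nat) :
  0 < q -> q <= 1 - a -> expR (k%:R * a) <= q ^- k.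
Proof.
move=> q0 qa; rewrite expRM_natl -exprVn.
rewrite lerXn2r ?nnegrE ?expR_ge0 ?invr_ge0 ?(ltW q0) //.
rewrite -[expR a]invrK -expRN lef_pV2 ?posrE ?expR_gt0 //.
exact: le_trans qa (expR_ge1Dx _).
Qed.

(** Of the factor 5, one unit pays for [ln r] and four for the constant, since
[exp 4 >= 2 ^ 4 = 16]. *)
Lemma expR_log_budget (R : realType) (r t : R) :
  0 < r -> 5 * Num.max 1 (ln r) <= t -> 16 * r <= expR t.
Proof.
move=> r0 ht; have [m1 m2] : 1 <= Num.max 1 (ln r) /\ ln r <= Num.max 1 (ln r).
  by rewrite !le_max !lexx orbT.
have H : 4%:R * 1 + ln r <= t by lra.
apply: le_trans (_ : expR (4%:R * 1 + ln r) <= _); last by rewrite ler_expR.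
rewrite expRD lnK ?posrE // ler_pM2r // expRM_natl.
have e2 : (2 : R) <= expR 1 by apply: le_trans (expR_ge1Dx 1); lra.
have -> : (16 : R) = 2 ^+ 4 by ring.
by rewrite lerXn2r ?nnegrE ?expR_ge0.
Qed.

Theorem corollary3p5 (R : realType) :
  exists C : R, 0 < C /\
    forall (n : nat) (f : 'rV[R]_n -> R) (L mu beta R0 : R)
      (xs x0 : 'rV[R]_n) (x : nat -> 'rV[R]_n),
    0 < L -> 0 <= mu ->
    L_smooth L f -> strongly_convex mu f -> minimizer f xs ->
    0 <= beta -> beta < 1 ->
    0 < R0 -> norm2 (x0 - xs) <= R0 ->
    let alpha := wahb_stepsize L beta in
    x 0%N = x0 -> x 1%N = x0 - alpha *: grad f x0 ->
    heavy_ball f alpha beta x ->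
    let xbar := weighted_avg (wahb_weight alpha beta mu) x in
    forall eps : R, 0 < eps ->
      (0 < mu -> forall K : nat,
         C * (L / mu + L * Num.sqrt beta / (mu * (1 - beta)))
           * Num.max 1
               (ln (L * R0 ^+ 2 * (1 + Num.sqrt beta / (1 - beta)) / eps))
           <= K%:R ->
         f (xbar K) - f xs <= eps) /\
      (mu = 0 -> forall K : nat,
         C * (L * R0 ^+ 2 / eps
              + L * R0 ^+ 2 * Num.sqrt beta / ((1 - beta) * eps)) <= K%:R ->
         f (xbar K) - f xs <= eps).
Proof.
exists 80; split=> // n f L mu beta R0 xs x0 x L0 mu0 fL fmu fmin b0 b1 R00 xR0.
move=> alpha x00 x1 hb xbar eps eps0.
have [n0|npos] := posnP n.
  subst n; have E K : f (xbar K) - f xs <= eps.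
    by rewrite (scalar_fun_dim0 f _ xs) subrr ltW.
  by split=> _ K _; exact: E.
have muL : mu <= L.
  case: n f xs x0 x fL fmu fmin xR0 x00 x1 hb xbar npos => // n f *.
  exact: (@strong_convexity_le_smoothness _ n L mu f).
have t0 : 0 < 1 - beta by rewrite subr_gt0.
have tn0 : 1 - beta != 0 by rewrite gt_eqF.
have epsn0 : eps != 0 by rewrite gt_eqF.
set S := 1 + Num.sqrt beta / _; pose A := L * R0 ^+ 2 * S.
have S1 : 1 <= S by rewrite lerDl divr_ge0 ?sqrtr_ge0 // ltW.
have S0 : 0 < S by apply: lt_le_trans S1.
have A0 : 0 < A by rewrite !mulr_gt0 // exprn_gt0.
pose w := wahb_weight alpha beta mu.
have bound K : (\sum_(0 <= i < K.+1) w i) * (f (xbar K) - f xs) <= 16 * A.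
  apply: le_trans (weighted_suboptimality K L0 mu0 muL fL fmu fmin b0 b1 _ hb) _.
    by rewrite x00.
  rewrite ler_pM2l // ler_pM2r // ler_pM2l // x00.
  by rewrite lerXn2r ?nnegrE ?norm2_ge0 // ltW.
(* Any lower bound c of the total weight turns the weighted bound into a rate. *)
have conclude K c : 0 < c -> c <= \sum_(0 <= i < K.+1) w i ->
    16 * A <= c * eps -> f (xbar K) - f xs <= eps.
  move=> c0 cW Ac; rewrite -(ler_pM2l c0); apply: le_trans Ac.
  apply: le_trans (bound K); rewrite ler_wpM2r // subr_ge0; exact: fmin.
split=> [mup K HK | mu_0 K HK].
- have mun0 : mu != 0 by rewrite gt_eqF.
  have [a0 aL1 _ aLb] := wahb_stepsizeP L0 b0 b1.
  rewrite -/alpha -/S in a0 aL1 aLb.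
  pose a := alpha * mu / (2 * (1 - beta)).
  have a8 : a <= 1 / 8.
    rewrite /a ler_pdivrMr ?mulr_gt0 //.
    have : alpha * mu <= alpha * L by rewrite ler_pM2l.
    by move=> ?; lra.
  have ap : 0 < a by rewrite divr_gt0 ?mulr_gt0.
  have aS : 1 <= 16 * (L / mu * S) * a.
    have -> : 16 * (L / mu * S) * a = 8 * L * alpha * S / (1 - beta).
      by rewrite /a; field; rewrite mun0 tn0.
    by rewrite ler_pdivlMr // mul1r.
  have w0 i : 0 < w i by rewrite invr_gt0 exprn_gt0 // -/a; lra.
  apply: (conclude _ (w K)) => //.
    by rewrite big_nat_recr //= lerDr sumr_ge0 // => i _; exact: ltW.
  rewrite -ler_pdivrMr // -mulrA.
  rewrite -/A in HK; set M := Num.max 1 _ in HK.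
  have M0 : 0 <= M by rewrite le_max ler01.
  apply: le_trans (_ : expR (K.+1%:R * a) <= _); last first.
    by apply: ge_expR_geometric; rewrite -/a //; lra.
  apply: expR_log_budget; first by rewrite divr_gt0.
  rewrite -/M; have Ka : K%:R * a <= K.+1%:R * a by rewrite ler_pM2r // ler_nat.
  apply: le_trans (le_trans (ler_wpM2r (ltW ap) HK) Ka).
  have -> : L / mu + L * Num.sqrt beta / (mu * (1 - beta)) = L / mu * S.
    by rewrite /S; field; rewrite mun0 tn0.
  by have := ler_wpM2r M0 aS; lra.
- have wE i : w i = 1.
    by rewrite /w /wahb_weight mu_0 mulr0 mul0r subr0 expr1n invr1.
  apply: (conclude _ (K.+1%:R)); first by rewrite ltr0Sn.
    by under eq_bigr do rewrite wE; rewrite sumr_const_nat subn0.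
  rewrite -ler_pdivrMr // -[K.+1%:R]natr1.
  have AE : L * R0 ^+ 2 / eps + L * R0 ^+ 2 * Num.sqrt beta / ((1 - beta) * eps)
      = A / eps by rewrite /A /S; field; rewrite epsn0 tn0.
  rewrite AE in HK.
  have : 0 < A / eps by rewrite divr_gt0.
  by move=> ?; lra.
Qed.
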